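(* Let $\mathbb{G}$ be the Gurariĭ space and let $\mathbf{\Omega}\colon\mathbb{G}\to\mathbb{G}$ be the non-expansive linear operator with the Gurariĭ property. Then $\mathbf{\Omega}$ is generic, i.e. in the infinite game of extending non-expansive operators between finite-dimensional normed spaces, Adam has a strategy making the resulting operator $T_\infty$ isometric to $\mathbf{\Omega}$.
   Context: All spaces are over a fixed scalar field ($\mathbb{R}$ or $\mathbb{C}$). An operator is non-expansive if its norm is at most $1$. For $\varepsilon>0$, an $\varepsilon$-embedding is a linear operator $f$ satisfying $(1-\varepsilon)\|x\|\le\|f(x)\|\le(1+\varepsilon)\|x\|$ for every $x$ in its domain. The Gurariĭ space $\mathbb{G}$ is the unique (up to linear isometry) separable Banach space such that for every $\varepsilon>0$, all finite-dimensional normed spaces $X_0\subseteq X$, and every linear isometric embedding $f_0\colon X_0\to\mathbb{G}$ there exists an $\varepsilon$-embedding $f\colon X\to\mathbb{G}$ with $f\restriction X_0=f_0$. Gurariĭ property of an operator $\mathbf{\Omega}\colon\mathbb{G}\to\mathbb{G}$: given $\varepsilon>0$, a non-expansive operator $T\colon X\to Y$ between finite-dimensional normed spaces, subspaces $X_0\subseteq X$, $Y_0\subseteq Y$ (with $T[X_0]\subseteq Y_0$) and linear isometric embeddings $i\colon X_0\to\mathbb{G}$, $j\colon Y_0\to\mathbb{G}$ such that $\mathbf{\Omega}\circ i=j\circ(T\restriction X_0)$, there exist $\varepsilon$-embeddings $i'\colon X\to\mathbb{G}$, $j'\colon Y\to\mathbb{G}$ satisfying $\|i'\restriction X_0-i\|\le\varepsilon$,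 $\|j'\restriction Y_0-j\|\le\varepsilon$ and $\|\mathbf{\Omega}\circ i'-j'\circ T\|\le\varepsilon$. A non-expansive operator on $\mathbb{G}$ with this property is known to exist and to be unique up to linear isometries. The game: two players, Eve and Adam, alternate, Eve moving first. Eve chooses a non-expansive linear operator $T_0\colon E_0\to F_0$ with $E_0,F_0$ finite-dimensional normed spaces. Adam responds with a non-expansive linear operator $T_1\colon E_1\to F_1$ with $E_1\supseteq E_0$, $F_1\supseteq F_0$ finite-dimensional normed spaces (the norms extending the previous ones) and $T_1$ extending $T_0$. Eve responds with a further such extension $T_2\colon E_2\to F_2$, and so on. After infinitely many steps one obtains a chain of non-expansive operators $T_n\colon E_n\to F_n$ ($n\in\omega$). Let $E_\infty$ and $F_\infty$ be the completions of $\bigcup_n E_n$ and $\bigcup_n F_n$, and let $T_\infty\colon E_\infty\to F_\infty$ be the (unique) non-expansive linear operator with $T_\infty\restriction E_n=T_n$ for every $n\in\omega$. A linear operator $U\colon X\to Y$ is generic if Adam has a strategy in this game making $T_\infty$ isometric to $U$. Operators $U,V$ are isometric if there are bijective linear isometries $i,j$ (between the respective codomains and domains) such that $U\circ j=i\circ V$. *)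

(* Defs.v *)
From HB Require Import structures.
From mathcomp Require Import all_boot all_order all_algebra.
From mathcomp Require Export complex.
From mathcomp Require Import all_classical all_reals all_analysis.

Set Implicit Arguments.
Unset Strict Implicit.
Unset Printing Implicit Defensive.

Import Order.TTheory GRing.Theory Num.Theory.
Import numFieldNormedType.Exports.

Local Open Scope classical_set_scope.
Local Open Scope ring_scope.
Local Open Scope complex_scope.

(* The norm of a [normedModType K] takes its values in K itself.  When K = R[i]
   the order is the partial one, for which 0 <= z holds exactly when z is a
   nonnegative real, so that an [eps : K] with [0 < eps] is a positive real. *)
Inductive real_or_complex : numFieldType -> Prop :=
| scalars_real (R : realType) : real_or_complex R
| scalars_complex (R : realType) : real_or_complex R[i].

#[short(type="normedVectType")]
HB.structure Definition NormedVector (K : numFieldType) :=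
  {V of NormedModule K V & Vector K V}.

(* A subspace of a finite-dimensional normed space carries the induced norm. *)
Section SubspaceNorm.
Context {K : numFieldType} {V : normedVectType K} (U : {vspace V}).

Let snorm (x : subvs_of U) : K := `|vsval x|.

Let snormD x y : snorm (x + y) <= snorm x + snorm y.
Proof. by rewrite /snorm linearD ler_normD. Qed.

Let snormZ (l : K) x : snorm (l *: x) = `|l| * snorm x.
Proof. by rewrite /snorm linearZ /= normrZ. Qed.

Let snorm0_eq0 x : snorm x = 0 -> x = 0.
Proof. by move=> /normr0_eq0 x0; apply/val_inj; rewrite /= x0. Qed.

HB.instance Definition _ :=
  @Lmodule_isNormed.Build K (subvs_of U) snorm snormD snormZ snorm0_eq0.

End SubspaceNorm.

Section Operators.
Context {K : numFieldType}.
Implicit Types X Y : normedModType K.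

(* The operator norm of f is at most c. *)
Definition opnorm_le X Y (c : K) (f : X -> Y) : Prop :=
  forall x, `|f x| <= c * `|x|.

Definition nonexpansive X Y (f : X -> Y) : Prop := opnorm_le 1 f.

Definition isometric_map X Y (f : X -> Y) : Prop := forall x, `|f x| = `|x|.

Definition eps_embedding X Y (eps : K) (f : {linear X -> Y}) : Prop :=
  forall x, (1 - eps) * `|x| <= `|f x| <= (1 + eps) * `|x|.

Definition isometric_ops X Y X' Y'
    (U : {linear X -> Y}) (V : {linear X' -> Y'}) : Prop :=
  exists (i : {linear Y' -> Y}) (j : {linear X' -> X}),
    [/\ bijective i, isometric_map i, bijective j, isometric_map j
      & forall x, U (j x) = i (V x)].

End Operators.

Section Gurarii.
Context {K : numFieldType}.

Definition separable_space (T : topologicalType) : Prop :=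
  exists2 A : set T, countable A & dense A.

Definition gurarii_space (G : completeNormedModType K) : Prop :=
  separable_space G /\
  forall (eps : K), 0 < eps ->
  forall (X : normedVectType K) (X0 : {vspace X})
         (f0 : {linear subvs_of X0 -> G}), isometric_map f0 ->
  exists2 f : {linear X -> G}, eps_embedding eps f
    & forall x : subvs_of X0, f (vsval x) = f0 x.

(* [vsproj Y0 (T (vsval x))] is the restriction of T to an operator X0 -> Y0:
   vsproj is the identity on Y0, which contains T[X0]. *)
Definition gurarii_operator (G : completeNormedModType K)
    (Omega : {linear G -> G}) : Prop :=
  forall (eps : K), 0 < eps ->
  forall (X Y : normedVectType K) (T : {linear X -> Y}), nonexpansive T ->
  forall (X0 : {vspace X}) (Y0 : {vspace Y}),
  (forall x, x \in X0 -> T x \in Y0) ->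
  forall (i : {linear subvs_of X0 -> G}) (j : {linear subvs_of Y0 -> G}),
  isometric_map i -> isometric_map j ->
  (forall x : subvs_of X0, Omega (i x) = j (vsproj Y0 (T (vsval x)))) ->
  exists (i' : {linear X -> G}) (j' : {linear Y -> G}),
    [/\ eps_embedding eps i', eps_embedding eps j',
        opnorm_le eps (fun x : subvs_of X0 => i' (vsval x) - i x),
        opnorm_le eps (fun y : subvs_of Y0 => j' (vsval y) - j y)
      & opnorm_le eps (fun x : X => Omega (i' x) - j' (T x))].

End Gurarii.

Section Game.
Variable K : numFieldType.

Record fin_op := FinOp {
  fdom : normedVectType K;
  fcod : normedVectType K;
  fop : {linear fdom -> fcod};
  fop_nonexp : nonexpansive fop }.

(* The inclusions E_n <= E_(n+1) and F_n <= F_(n+1) of the game are given as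
   linear isometric embeddings. *)
Record extension (T T' : fin_op) := Extension {
  edom : {linear fdom T -> fdom T'};
  ecod : {linear fcod T -> fcod T'};
  edom_isom : isometric_map edom;
  ecod_isom : isometric_map ecod;
  ext_fop : forall x, fop T' (edom x) = ecod (fop T x) }.

Record move (T : fin_op) := Move {
  target : fin_op;
  move_ext : extension T target }.

(* [history n T]: sequences of moves T_0, ..., T_n with T_n = T. *)
Inductive history : nat -> fin_op -> Type :=
| Start (T : fin_op) : history 0 T
| Step n (T T' : fin_op) : history n T -> extension T T' -> history n.+1 T'.

Record play := Play {
  op_at : nat -> fin_op;
  ext_at : forall n, extension (op_at n) (op_at n.+1) }.

Fixpoint history_of (p : play) (n : nat) : history n (op_at p n) :=
  match n return history n (op_at p n) with
  | 0 => Start (op_at p 0)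
  | m.+1 => Step (history_of p m) (ext_at p m)
  end.

(* Eve plays T_0, T_2, ... and Adam plays T_1, T_3, ...; only the answers of a
   strategy to histories T_0, ..., T_n with n even are ever used. *)
Definition adam_strategy := forall n (T : fin_op), history n T -> move T.

Definition follows (s : adam_strategy) (p : play) : Prop :=
  forall k, Move (ext_at p k.*2) = s _ _ (history_of p k.*2).

(* Einf is a completion of the union of the chain E_0 -> E_1 -> ... *)
Record completion_of_union (E : nat -> normedVectType K)
    (e : forall n, {linear E n -> E n.+1})
    (Einf : completeNormedModType K) := CompletionOfUnion {
  incl : forall n, {linear E n -> Einf};
  incl_isom : forall n, isometric_map (incl n);
  incl_comp : forall n x, incl n.+1 (e n x) = incl n x;
  incl_dense : dense (\bigcup_n range (incl n)) }.

Record limit_operator (p : play) := LimitOperator {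
  ldom : completeNormedModType K;
  lcod : completeNormedModType K;
  ldom_compl : completion_of_union (fun n => edom (ext_at p n)) ldom;
  lcod_compl : completion_of_union (fun n => ecod (ext_at p n)) lcod;
  lop : {linear ldom -> lcod};
  lop_nonexp : nonexpansive lop;
  lop_ext : forall n x,
    lop (incl ldom_compl n x) = incl lcod_compl n (fop (op_at p n) x) }.

(* The completions, hence T_oo, are determined up to linear isometry: T_oo
   exists, and whichever completions are chosen it is isometric to U. *)
Definition generic (X Y : normedModType K) (U : {linear X -> Y}) : Prop :=
  exists s : adam_strategy, forall p : play, follows s p ->
    inhabited (limit_operator p) /\
    forall L : limit_operator p, isometric_ops (lop L) U.

End Game.

(* Main.v *)
Require Import Defs.
From HB Require Import structures.
From mathcomp Require Import all_boot all_order all_algebra.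
From mathcomp Require Import all_classical all_reals all_analysis.
From mathcomp Require Import ring.

Set Implicit Arguments.
Unset Strict Implicit.
Unset Printing Implicit Defensive.

Import Order.TTheory GRing.Theory Num.Theory.
Import numFieldNormedType.Exports.

Local Open Scope classical_set_scope.
Local Open Scope ring_scope.

(** Adam plays so that the chain converges to [Omega] itself.  Throughout the
    game he keeps finite-dimensional subspaces of [G], between which [Omega]
    acts, embedded isometrically into the current domain and codomain in such a
    way that [Omega] becomes the restriction of the current operator [T : E -> F]
    ([state]).  In round [k] the Gurarii property extends these partial
    identifications, up to an error [2^-k], to almost isometric embeddings
    [I : E -> G] and [J : F -> G] with [Omega \o I] close to [J \o T].  Let [A]
    be a finite-dimensional subspace of [G] containing the image of [I] and the
    first vectors of a dense sequence of [G], and let [B] be one containing the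
    image of [J], the same vectors and [Omega A].  Adam answers with the
    amalgams of [E] with [A] and of [F] with [B], normed so that [x] lies close
    to [I x], and [y] to [J y] ([exists_amalgam]); the universal property of the
    amalgam of [E] and [A] glues [T] and the restriction of [Omega] to [A] into
    one nonexpansive operator, and [A], [B] form the next state
    ([exists_good_round]).

    Because [I x] and [x] are close in the amalgam and the next embedding almost
    preserves [I x], the embeddings of a fixed stage of the chain obtained in
    consecutive rounds differ by at most [6 * 2^-k].  Since [G] is complete they
    converge, to isometric embeddings, and the union of the images is dense as
    the dense sequence is absorbed ([exists_limit_embedding]).  Hence [G] is a
    completion of both unions, no abstract completion being needed, and in the
    limit [Omega] extends every operator of the chain ([limit_intertwines]).
    Completions of the same chain are isometric over the chain
    ([completion_unique]), so every choice of the limit operator is isometric to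
    [Omega].

    Norms take values in the scalar field, so the infimum in the norm of the
    amalgam exists thanks to [nonneg_glb], which treats real and complex scalars
    separately.  It is the only place where they are distinguished. *)

(** * Scalars *)

Section Scalars.
Context {K : numFieldType} (HK : real_or_complex K).

(** A set of nonnegative scalars has a greatest lower bound, although the order
    of the complex numbers is partial: such a set consists of real numbers. *)
Lemma nonneg_glb (S : set K) : S !=set0 -> (forall s, S s -> 0 <= s) ->
  exists m : K, (forall s, S s -> m <= s) /\
    forall l, (forall s, S s -> l <= s) -> l <= m.
Proof.
case: HK S => R S [s0 Ss0] S_ge0.
  exists (inf S); split=> [s Ss|l lS].
    by apply: ge_inf => //; exists 0 => t; exact: S_ge0.
  by apply: lb_le_inf => //; exists s0.
pose S' : set R := [set complex.Re s | s in S].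
have S'0 : S' !=set0 by exists (complex.Re s0), s0.
have S_real s : S s -> complex.Im s = 0.
  by move=> /S_ge0; rewrite lecE /= => /andP[/eqP].
exists (Complex (inf S') 0); split=> [s Ss|l lS].
  rewrite lecE /= S_real// eqxx /=; apply: ge_inf; last by exists s.
  by exists 0 => _ [t /S_ge0 + <-]; rewrite lecE /= => /andP[].
have := lS _ Ss0; rewrite lecE => /andP[/eqP l_real _].
rewrite lecE -l_real (S_real _ Ss0) eqxx /=.
by apply: lb_le_inf => // _ [t /lS + <-]; rewrite lecE => /andP[].
Qed.

(** The tolerance [2^-n] of round [n]. *)
Definition pow2N (n : nat) : K := 2%:R ^- n.

Lemma pow2N_gt0 n : 0 < pow2N n.
Proof. by rewrite /pow2N invr_gt0 exprn_gt0. Qed.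

Lemma pow2N_ge0 n : 0 <= pow2N n. Proof. exact/ltW/pow2N_gt0. Qed.

Lemma pow2N_double n : pow2N n.+1 + pow2N n.+1 = pow2N n.
Proof.
by rewrite /pow2N exprS invfM -mulr2n -mulrnAl -mulr_natr mulVf ?pnatr_eq0 ?mul1r.
Qed.

Lemma le_pow2N m n : (m <= n)%N -> pow2N n <= pow2N m.
Proof.
move=> /subnK <-; elim: (n - m)%N => // k IH; rewrite addSn.
by apply: le_trans IH; rewrite -(pow2N_double (k + m)) lerDl pow2N_ge0.
Qed.

Lemma pow2N_le1 n : pow2N n <= 1.
Proof. by rewrite (le_trans (le_pow2N (leq0n n)))// /pow2N expr0 invr1. Qed.

(** The scalars are Archimedean: otherwise the greatest lower bound [m] of the
    [c * 2^-n] would satisfy [m + m <= m] without being [0]. *)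
Lemma le_pow2N_eq0 (a c : K) n0 : 0 <= a -> 0 <= c ->
  (forall n, (n0 <= n)%N -> a <= c * pow2N n) -> a = 0.
Proof.
move=> a0 c0 ac.
have [|s [n _ <-]|m [mlb mglb]] := @nonneg_glb (range (fun n => c * pow2N n)).
- by exists (c * pow2N 0), 0%N.
- by rewrite mulr_ge0 ?pow2N_ge0.
have : m + m <= m.
  apply: mglb => _ [n _ <-]; rewrite -pow2N_double mulrDr.
  by apply: lerD; apply: mlb; exists n.+1.
rewrite gerDl => m0; apply/eqP; rewrite eq_le a0 andbT.
apply: le_trans m0; apply: mglb => _ [n _ <-].
apply: (le_trans (ac (maxn n0 n) _)); first exact: leq_maxl.
by rewrite ler_wpM2l// le_pow2N// leq_maxr.
Qed.

Lemma pow2N_lt (e : K) : 0 < e -> exists n, pow2N n < e.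
Proof.
move=> e0; apply: contrapT => /forallNP ne.
suff e_eq0 : e = 0 by rewrite e_eq0 ltxx in e0.
apply: (@le_pow2N_eq0 _ 1 0 (ltW e0)) => // n _; rewrite mul1r.
have [//| /ne//] := real_leP (gtr0_real e0) (gtr0_real (pow2N_gt0 n)).
Qed.

End Scalars.

(** * Linear maps and finite-dimensional normed spaces *)

Section LinearMaps.
Context {K : numFieldType}.

Lemma exists_linear (U V : lmodType K) (f : U -> V) :
  linear f -> exists g : {linear U -> V}, forall x, g x = f x.
Proof.
move=> f_lin; pose L := GRing.isLinear.Build K U V *:%R f f_lin.
by exists (HB.pack f L : {linear U -> V}).
Qed.

Lemma isometric_map_inj (X Y : normedModType K) (f : {linear X -> Y}) :
  isometric_map f -> injective f.
Proof.
move=> f_isom x y fxy; apply/eqP; rewrite -subr_eq0 -normr_eq0 -f_isom.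
by rewrite linearB fxy subrr normr0.
Qed.

Lemma isometric_map_comp (X Y Z : normedModType K)
    (f : {linear X -> Y}) (g : {linear Y -> Z}) :
  isometric_map f -> isometric_map g -> isometric_map (g \o f).
Proof. by move=> f_isom g_isom x; rewrite /= g_isom f_isom. Qed.

Lemma exists_linear_lift (V A G : lmodType K)
    (psi : {linear A -> G}) (phi : {linear V -> G}) : injective psi ->
  (forall v, exists a, psi a = phi v) ->
  exists l : {linear V -> A}, forall v, psi (l v) = phi v.
Proof.
move=> psi_inj /choice[l lP].
have l_lin : linear l by move=> k x y; apply: psi_inj; rewrite !(lP, linearP).
by have [g gE] := exists_linear l_lin; exists g => v; rewrite gE.
Qed.

Lemma exists_linear_pair (U V G : lmodType K)
    (f : {linear U -> G}) (g : {linear V -> G}) :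
  exists h : {linear (U * V)%type -> G}, forall x, h x = f x.1 + g x.2.
Proof.
have [|h hE] := @exists_linear (U * V)%type G (fun x => f x.1 + g x.2).
  by move=> k x y /=; rewrite !linearP /= scalerDr addrACA.
by exists h.
Qed.

Lemma exists_linear_span (G : lmodType K) n (v : 'I_n -> G) :
  exists h : {linear 'rV[K]_n -> G}, forall i, exists c, h c = v i.
Proof.
have [|h hE] := @exists_linear 'rV[K]_n G (fun c => \sum_i c 0 i *: v i).
  move=> k x y; rewrite scaler_sumr -big_split /=; apply: eq_bigr => i _.
  by rewrite !mxE scalerDl scalerA.
exists h => i; exists (delta_mx 0 i); rewrite hE (bigD1 i)//= mxE !eqxx scale1r.
by rewrite big1 ?addr0// => j /negPf ji; rewrite mxE ji andbF scale0r.
Qed.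

End LinearMaps.

(** [N] is a norm on [V] (its nonnegativity follows from the axioms). *)
Record is_norm (K : numFieldType) (V : lmodType K) (N : V -> K) : Prop := IsNorm {
  is_normD : forall x y, N (x + y) <= N x + N y;
  is_normZ : forall l x, N (l *: x) = `|l| * N x;
  is_norm0_eq0 : forall x, N x = 0 -> x = 0 }.

(** The finite-dimensional space [V], with the norm [N]. *)
Definition renorm (K : numFieldType) (V : vectType K) (N : V -> K)
  (HN : is_norm N) : Type := V.

Section Renorm.
Context {K : numFieldType} (V : vectType K) (N : V -> K) (HN : is_norm N).

HB.instance Definition _ := Vector.on (renorm HN).
HB.instance Definition _ := @Lmodule_isNormed.Build K (renorm HN) N
  (is_normD HN) (is_normZ HN) (is_norm0_eq0 HN).

Lemma renormE (x : renorm HN) : `|x| = N x. Proof. by []. Qed.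

End Renorm.

Section FiniteDimensional.
Context {K : numFieldType}.

(** The image of a finite-dimensional space under a linear map into a normed
    space is a finite-dimensional normed space: it is isometric to a subspace of
    maximal dimension among those on which the map is injective. *)
Lemma exists_fin_dim_image (V : vectType K) (G : normedModType K)
    (phi : {linear V -> G}) :
  exists (A : normedVectType K) (psi : {linear A -> G}),
    isometric_map psi /\ forall v, exists a, psi a = phi v.
Proof.
pose inj_on (U : {vspace V}) := forall x, x \in U -> phi x = 0 -> x = 0.
pose P d := `[< exists2 U, inj_on U & \dim U = d >].
have exP : exists d, P d.
  exists 0%N; apply/asboolP; exists 0%VS; last exact: dimv0.
  by move=> x; rewrite memv0 => /eqP.
have leP d : P d -> (d <= \dim {:V})%N.
  by case/asboolP=> U _ <-; rewrite dimvS// subvf.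
case: (ex_maxnP exP leP) => d /asboolP[U U_inj U_dim] max_d.
have phi_U v : exists2 u, u \in U & phi u = phi v.
  apply: contrapT => nv.
  have : inj_on (U + <[v]>)%VS.
    move=> _ /memv_addP[u uU] [_ /vlineP[k ->] ->].
    rewrite linearD linearZ /=.
    have [->|k0] := eqVneq k 0; first by rewrite !scale0r !addr0; exact: U_inj.
    move=> /eqP; rewrite addr_eq0 => /eqP phi_u; case: nv.
    exists (- k^-1 *: u); first by rewrite memvZ.
    by rewrite linearZ /= phi_u scalerN scaleNr opprK scalerA mulVf ?scale1r.
  move=> Uv_inj; have /max_d : P (\dim (U + <[v]>)%VS).
    by apply/asboolP; exists (U + <[v]>)%VS.
  rewrite -U_dim => dim_le; apply: nv; exists v => //.
  have /eqP -> : U == (U + <[v]>)%VS by rewrite eqEdim addvSl.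
  by rewrite -[v in v \in _]add0r memv_add ?mem0v ?memv_line.
have norm_phi : is_norm (fun x : subvs_of U => `|phi (vsval x)|).
  split=> [x y|l x|x /normr0_eq0 phix].
  - by rewrite !linearD ler_normD.
  - by rewrite !linearZ /= normrZ.
  - by apply/val_inj/U_inj => //; exact: subvsP.
exists (renorm norm_phi : normedVectType K).
have [|psi psiE] := @exists_linear K (renorm norm_phi) G (fun x => phi (vsval x)).
  by move=> k x y /=; rewrite !linearP.
exists psi; split=> [x|v]; first by rewrite psiE renormE.
have [u uU <-] := phi_U v; exists (vsproj U u : renorm norm_phi).
by rewrite psiE /= vsprojK.
Qed.

End FiniteDimensional.

(** * Amalgamation along an almost isometric map *)

Section Amalgam.
Context {K : numFieldType} (HK : real_or_complex K).

(** The quotient seminorm [x |-> inf_z p x z] of a seminorm [p] on [V * W]. *)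
Lemma exists_quotient_seminorm (V W : lmodType K) (p : V -> W -> K) :
  (forall x z, 0 <= p x z) ->
  (forall x y z w, p (x + y) (z + w) <= p x z + p y w) ->
  (forall l x z, p (l *: x) (l *: z) <= `|l| * p x z) ->
  exists N : V -> K,
    [/\ forall x z, N x <= p x z,
        forall x l, (forall z, l <= p x z) -> l <= N x,
        forall x y, N (x + y) <= N x + N y
      & forall l x, N (l *: x) = `|l| * N x].
Proof.
move=> p_ge0 pD pZ.
have /choice[N NP] x : exists m : K, (forall z, m <= p x z) /\
    forall l, (forall z, l <= p x z) -> l <= m.
  have [||m [mlb mglb]] := nonneg_glb HK (S := range (p x)).
  - by exists (p x 0), 0.
  - by move=> _ [z _ <-].
  exists m; split=> [z|l lp]; first by apply: mlb; exists z.
  by apply: mglb => _ [z _ <-].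
have N_le x z : N x <= p x z by case: (NP x).
have le_N x l : (forall z, l <= p x z) -> l <= N x by case: (NP x) => _; exact.
have NZ_le l x : N (l *: x) <= `|l| * N x.
  have [->|l0] := eqVneq l 0.
    rewrite normr0 mul0r (le_trans (N_le _ (0 *: 0)))//.
    by rewrite (le_trans (pZ _ _ _))// normr0 mul0r.
  rewrite mulrC -ler_pdivrMr ?normr_gt0//; apply: (le_N) => z.
  by rewrite ler_pdivrMr ?normr_gt0// mulrC (le_trans (N_le _ (l *: z))).
exists N; split=> //.
  move=> x y; rewrite -lerBlDr; apply: (le_N) => z.
  rewrite lerBlDr [p x z + _]addrC -lerBlDr.
  apply: (le_N) => w; rewrite lerBlDr [p y w + _]addrC.
  by rewrite (le_trans (N_le _ (z + w))).
move=> l x; apply/eqP; rewrite eq_le NZ_le /=.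
have [->|l0] := eqVneq l 0.
  by rewrite normr0 mul0r; apply: le_N.
rewrite mulrC -ler_pdivlMr ?normr_gt0// mulrC -normfV.
by rewrite -{1}[x]scale1r -(mulVf l0) -scalerA NZ_le.
Qed.

(** [Z] is the pushout, for nonexpansive maps, of [E] and [A] under the
    condition that [x] and [I x] be at distance at most [c * `|x|]: it is
    [E * A] with the norm [inf_z `|x - z| + `|a + I z| + c * `|z|]. *)
Lemma exists_amalgam (eps c : K) (E A : normedVectType K)
    (I : {linear E -> A}) : 0 < c -> eps <= c -> eps_embedding eps I ->
  exists (Z : normedVectType K) (iE : {linear E -> Z}) (iA : {linear A -> Z}),
    [/\ isometric_map iE, isometric_map iA,
        forall x, `|iA (I x) - iE x| <= c * `|x|
      & forall (W : normedModType K) (f : {linear E -> W}) (g : {linear A -> W}),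
        nonexpansive f -> nonexpansive g ->
        (forall x, `|g (I x) - f x| <= c * `|x|) ->
        exists h : {linear Z -> W}, [/\ nonexpansive h,
          forall x, h (iE x) = f x & forall a, h (iA a) = g a]].
Proof.
move=> c0 ec I_emb.
pose p (x : E * A) (z : E) : K := `|x.1 - z| + `|x.2 + I z| + c * `|z|.
have p_ge0 x z : 0 <= p x z by rewrite !addr_ge0 ?mulr_ge0 ?normr_ge0// ltW.
have [||N [N_le le_N ND NZ]] := exists_quotient_seminorm p_ge0.
- move=> [x a] [y b] z w; rewrite /p /=.
  have -> : `|x - z| + `|a + I z| + c * `|z| + (`|y - w| + `|b + I w| + c * `|w|)
      = `|x - z| + `|y - w| + (`|a + I z| + `|b + I w|) + c * (`|z| + `|w|).
    by ring.
  rewrite lerD ?ler_wpM2l ?ler_normD ?(ltW c0)// lerD//.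
    by rewrite opprD addrACA ler_normD.
  by rewrite linearD addrACA ler_normD.
- move=> l [x a] z; rewrite /p /= [I _]linearZ /= -scalerBr -scalerDr.
  by rewrite !normrZ !mulrDr mulrCA.
have N_E x : N (x, 0) = `|x|.
  apply/eqP; rewrite eq_le; apply/andP; split.
    by rewrite (le_trans (N_le _ 0))// /p /= [I 0]linear0 !(subr0, addr0, normr0, mulr0).
  apply: (le_N) => z; rewrite /p /= add0r -addrA.
  rewrite -{1}[x](subrK z) (le_trans (ler_normD _ _))// lerD2l.
  have /andP[+ _] := I_emb z; rewrite mulrBl mul1r lerBlDr => /le_trans; apply.
  by rewrite lerD2l ler_wpM2r.
have N_A a : N (0, a) = `|a|.
  apply/eqP; rewrite eq_le; apply/andP; split.
    rewrite (le_trans (N_le _ 0))// /p /= [I 0]linear0.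
    by rewrite !(subr0, addr0, normr0, mulr0, add0r).
  apply: (le_N) => z; rewrite /p /= sub0r normrN.
  rewrite -{1}[a](addrK (I z)) (le_trans (ler_normB _ _))//.
  rewrite [`|z| + _]addrC -addrA lerD2l.
  have /andP[_] := I_emb z; rewrite mulrDl mul1r => /le_trans; apply.
  by rewrite lerD2l ler_wpM2r.
have N_graph x : N (x, - I x) <= c * `|x|.
  by rewrite (le_trans (N_le _ x))// /p /= subrr addNr !normr0 !add0r.
have norm_N : is_norm N.
  split=> // -[x a] Nxa0.
  (* c |x| <= (1 + c) p (x, a) z for every z *)
  have x0 : x = 0.
    apply/normr0_eq0/eqP; rewrite eq_le normr_ge0 andbT.
    have cc0 : 0 < 1 + c by rewrite addr_gt0.
    rewrite -(pmulr_rle0 _ (divr_gt0 c0 cc0)) -Nxa0; apply: (le_N) => z.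
    rewrite mulrAC ler_pdivrMr// /p /=.
    have -> : (`|x - z| + `|a + I z| + c * `|z|) * (1 + c) = c * (`|x - z| + `|z|)
        + (`|x - z| + `|a + I z| * (1 + c) + c * c * `|z|) by ring.
    rewrite -[leLHS]addr0 lerD//.
      by rewrite ler_wpM2l ?(ltW c0)// -{1}[x](subrK z) ler_normD.
    by rewrite !addr_ge0 ?mulr_ge0 ?normr_ge0// ltW.
  by move: Nxa0; rewrite x0 N_A => /normr0_eq0 ->.
have [|iE iEE] := @exists_linear K E (renorm norm_N) (fun x => (x, 0)).
  by move=> k x y /=; congr pair; rewrite /= scaler0 addr0.
have [|iA iAE] := @exists_linear K A (renorm norm_N) (fun a => (0, a)).
  by move=> k x y /=; congr pair; rewrite /= scaler0 addr0.
exists (renorm norm_N : normedVectType K), iE, iA; split.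
- by move=> x; rewrite iEE renormE N_E.
- by move=> x; rewrite iAE renormE N_A.
- move=> x; rewrite iAE iEE distrC renormE (le_trans _ (N_graph x))//.
  rewrite le_eqVlt; apply/orP; left; apply/eqP.
  by congr N; congr pair; rewrite /= ?subr0 ?sub0r.
move=> W f g f_ne g_ne fg; have [h hE] := exists_linear_pair f g.
exists (h : {linear renorm norm_N -> W}); split=> [x|x|a].
- rewrite mul1r renormE; apply: (le_N) => z; rewrite hE /p.
  have -> : f x.1 + g x.2 = f (x.1 - z) + g (x.2 + I z) - (g (I z) - f z).
    by rewrite [f (_ - _)]linearB [g (_ + _)]linearD opprB /= addrACA subrK addrK.
  rewrite (le_trans (ler_normB _ _))// lerD// (le_trans (ler_normD _ _))// lerD//.
  + by have := f_ne (x.1 - z); rewrite mul1r.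
  + by have := g_ne (x.2 + I z); rewrite mul1r.
- by rewrite hE iEE /= linear0 addr0.
- by rewrite hE iAE /= linear0 add0r.
Qed.

End Amalgam.

(** * One round of the game *)

Section Overlaps.
Context {K : numFieldType} (G : completeNormedModType K).

(** A finite-dimensional normed space that is a subspace both of [E] and of
    [G]. *)
Record overlap (E : normedVectType K) := Overlap {
  common : normedVectType K;
  toE : {linear common -> E};
  toG : {linear common -> G};
  toE_isom : isometric_map toE;
  toG_isom : isometric_map toG }.

Lemma zero_space_isometric (V : normedVectType K) (W : normedModType K)
    (f : {linear subvs_of (0%VS : {vspace V}) -> W}) : isometric_map f.
Proof.
move=> x; suff -> : x = 0 by rewrite linear0 !normr0.
by apply/val_inj/eqP; rewrite -memv0 subvsP.
Qed.

(** The zero overlap. *)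
Definition overlap0 (E : normedVectType K) : overlap E :=
  @Overlap E (subvs_of (0%VS : {vspace E}))
    (vsval : {linear subvs_of (0%VS : {vspace E}) -> E})
    (\0 : {linear subvs_of (0%VS : {vspace E}) -> G})
    (@zero_space_isometric E E _) (@zero_space_isometric E G _).

(** The overlap of [E] with [G], seen in the larger space [E']. *)
Definition overlap_push (E E' : normedVectType K) (e : {linear E -> E'})
    (e_isom : isometric_map e) (s : overlap E) : overlap E' :=
  @Overlap E' (common s) (e \o toE s) (toG s)
    (isometric_map_comp (@toE_isom _ s) e_isom) (@toG_isom _ s).


Variable v : nat -> G.

(** [I] is an almost isometric embedding of [E] into [G] that almost agrees with
    the overlap [s]; the overlap [s'] of [E'] with [G] contains the image of
    [I] and the vectors [v 0], ..., [v k], and identifies [I x] with a vector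
    close to the image [e x] of [x] in [E']. *)
Record refines (k : nat) (E E' : normedVectType K) (e : E -> E')
    (s : overlap E) (s' : overlap E') (I : {linear E -> G}) : Prop := Refines {
  refines_emb : eps_embedding (pow2N k) I;
  refines_near : forall a, `|I (toE s a) - toG s a| <= pow2N k * `|a|;
  refines_in : forall x, exists a, toG s' a = I x /\
    `|toE s' a - e x| <= (pow2N k + pow2N k) * `|x|;
  refines_seq : forall m, (m <= k)%N -> exists a, toG s' a = v m }.

Lemma refines_push k (E E' E'' : normedVectType K) (e : E -> E')
    (e' : {linear E' -> E''}) (e'_isom : isometric_map e') s s' I :
  refines k e s s' I -> refines k (e' \o e) s (overlap_push e'_isom s') I.
Proof.
case=> I_emb I_near I_in v_in; split=> // x.
have [a [aI a_near]] := I_in x; exists a; split=> //=.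
by rewrite -linearB e'_isom.
Qed.

End Overlaps.

Lemma normr_vsproj (K : numFieldType) (V : normedVectType K) (U : {vspace V}) x :
  x \in U -> `|vsproj U x| = `|x|.
Proof. by move=> xU; rewrite -{2}(vsprojK xU). Qed.

Section Round.
Context {K : numFieldType} (HK : real_or_complex K).
Context {G : completeNormedModType K} (Omega : {linear G -> G}) (v : nat -> G).
Hypotheses (HOmega : nonexpansive Omega) (HOmegaG : gurarii_operator Omega).

(** Overlaps of the domain and the codomain of [T] with [G] on which [T] and
    [Omega] coincide. *)
Record state (T : fin_op K) := State {
  sdom : overlap G (fdom T);
  scod : overlap G (fcod T);
  state_compat : forall a, exists b, fop T (toE sdom a) = toE scod b /\
    Omega (toG sdom a) = toG scod b }.

(** The state before any identification has been made. *)
Program Definition state0 (T : fin_op K) : state T :=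
  @State T (overlap0 G (fdom T)) (overlap0 G (fcod T)) _.
Next Obligation.
move=> T a; exists 0 => /=; rewrite linear0; split=> //.
suff -> : a = 0 by rewrite !linear0.
by apply/val_inj/eqP; rewrite -memv0 subvsP.
Qed.

(** The same identifications, after a further move [e]. *)
Program Definition state_push (T T' : fin_op K) (e : extension T T')
    (s : state T) : state T' :=
  @State T' (overlap_push (edom_isom e) (sdom s))
    (overlap_push (ecod_isom e) (scod s)) _.
Next Obligation.
move=> T T' e s a; have [b [Tab Oab]] := state_compat a.
by exists b; split=> //=; rewrite ext_fop Tab.
Qed.

(** The Gurarii property of [Omega], for abstract overlaps in place of
    subspaces. *)
Lemma gurarii_state (T : fin_op K) (s : state T) (eps : K) : 0 < eps ->
  exists (I : {linear fdom T -> G}) (J : {linear fcod T -> G}),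
    [/\ eps_embedding eps I, eps_embedding eps J,
        forall a, `|I (toE (sdom s) a) - toG (sdom s) a| <= eps * `|a|,
        forall b, `|J (toE (scod s) b) - toG (scod s) b| <= eps * `|b|
      & opnorm_le eps (fun x => Omega (I x) - J (fop T x))].
Proof.
move=> eps0.
(* an overlap yields a subspace [U] of [E] and an isometry of [U] into [G] *)
have transfer (E : normedVectType K) (o : overlap G E) :
    exists (U : {vspace E}) (i : {linear subvs_of U -> G}),
    [/\ isometric_map i, forall a, toE o a \in U,
        forall x, x \in U -> exists a, x = toE o a
      & forall x a, vsval x = toE o a -> i x = toG o a].
  pose U := limg (linfun (toE o)).
  have inU a : toE o a \in U by rewrite -[toE o a]lfunE memv_img ?memvf.
  have [x|l lE] := @exists_linear_lift K (subvs_of U) _ _ (toE o) vsval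
      (isometric_map_inj (@toE_isom _ _ _ o)).
    by have /memv_imgP[a _ xa] := subvsP x; exists a; rewrite [RHS]xa lfunE.
  exists U, (toG o \o l); split=> // [x|x /memv_imgP[a _ ->]|x a xa] /=.
  - by rewrite toG_isom -(@toE_isom _ _ _ o) lE.
  - by exists a; rewrite lfunE.
  - have <- : l x = a by apply: (isometric_map_inj (@toE_isom _ _ _ o)); rewrite lE.
    by [].
have [X0 [i [i_isom inX0 X0_in iE]]] := transfer _ (sdom s).
have [Y0 [j [j_isom inY0 _ jE]]] := transfer _ (scod s).
have [||I [J [I_emb J_emb I_near J_near IJ]]] :=
  HOmegaG eps0 (@fop_nonexp _ T) (X0 := X0) (Y0 := Y0) _ i_isom j_isom.
- move=> _ /X0_in[a ->]; have [b [-> _]] := state_compat a.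
  exact: inY0.
- move=> x; have [a xa] := X0_in _ (subvsP x); rewrite (iE _ _ xa) xa.
  have [b [Tab ->]] := state_compat a.
  by rewrite (jE _ b)// vsprojK Tab.
exists I, J; split=> // [a|b].
  have /= := I_near (vsproj X0 (toE (sdom s) a)).
  by rewrite (iE _ a) vsprojK// normr_vsproj// toE_isom.
have /= := J_near (vsproj Y0 (toE (scod s) b)).
by rewrite (jE _ b) vsprojK// normr_vsproj// toE_isom.
Qed.

(** Adam's [k]-th answer [e : T -> T'] turns the state [s] into [s'] by means
    of almost isometric embeddings [I], [J] that almost intertwine [T] and
    [Omega]. *)
Definition good_round (k : nat) (T T' : fin_op K) (e : extension T T')
    (s : state T) (s' : state T')
    (I : {linear fdom T -> G}) (J : {linear fcod T -> G}) : Prop :=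
  [/\ refines v k (edom e) (sdom s) (sdom s') I,
      refines v k (ecod e) (scod s) (scod s') J
    & opnorm_le (pow2N k) (fun x => Omega (I x) - J (fop T x))].

Lemma exists_good_round k (T : fin_op K) (s : state T) :
  exists (m : move T) (s' : state (target m))
    (I : {linear fdom T -> G}) (J : {linear fcod T -> G}),
    good_round k (move_ext m) s s' I J.
Proof.
have eps0 : 0 < pow2N k :> K by exact: pow2N_gt0.
have [I [J [I_emb J_emb I_near J_near IJ]]] := gurarii_state s eps0.
have [w wE] := exists_linear_span (fun m : 'I_k.+1 => v m).
(* A is the span of the image of I and v 0, ..., v k *)
have [phiA phiAE] := exists_linear_pair I w.
have [A [psiA [psiA_isom psiA_on]]] := exists_fin_dim_image phiA.
have psiA_inj := isometric_map_inj psiA_isom.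
have [|IA IAE] := exists_linear_lift psiA_inj (phi := I).
  by move=> x; have [a aE] := psiA_on (x, 0); exists a; rewrite aE phiAE linear0 addr0.
have psiA_v m : (m <= k)%N -> exists a, psiA a = v m.
  move=> mk; have [c cE] := wE (Ordinal (mk : (m < k.+1)%N)).
  have [a aE] := psiA_on (0, c).
  by exists a; rewrite aE phiAE linear0 add0r cE.
(* B contains, moreover, the image of A under Omega *)
have [phiB' phiB'E] := exists_linear_pair J w.
have [phiB phiBE] := exists_linear_pair phiB' (Omega \o psiA).
have [B [psiB [psiB_isom psiB_on]]] := exists_fin_dim_image phiB.
have psiB_inj := isometric_map_inj psiB_isom.
have [|JB JBE] := exists_linear_lift psiB_inj (phi := J).
  move=> y; have [b bE] := psiB_on ((y, 0), 0).
  by exists b; rewrite bE phiBE linear0 addr0 phiB'E linear0 addr0.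
have [|OB OBE] := exists_linear_lift psiB_inj (phi := Omega \o psiA).
  by move=> a; have [b bE] := psiB_on (0, a); exists b; rewrite bE phiBE linear0 add0r.
have psiB_v m : (m <= k)%N -> exists b, psiB b = v m.
  move=> mk; have [c cE] := wE (Ordinal (mk : (m < k.+1)%N)).
  have [b bE] := psiB_on ((0, c), 0).
  by exists b; rewrite bE phiBE linear0 addr0 phiB'E linear0 add0r cE.
have IA_emb : eps_embedding (pow2N k) IA.
  by move=> x; rewrite -[`|IA x|]psiA_isom IAE.
have JB_emb : eps_embedding (pow2N k) JB.
  by move=> x; rewrite -[`|JB x|]psiB_isom JBE.
(* The domain needs twice the tolerance of the codomain: passing from T x to
   the image of Omega (I x) costs one pow2N k for y ~ J y in F', and another
   for Omega \o I ~ J \o T. *)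
have eps2 : 0 < pow2N k + pow2N k :> K by rewrite addr_gt0.
have le_eps2 : pow2N k <= pow2N k + pow2N k :> K by rewrite lerDl ltW.
have [E' [iE [iA [iE_isom iA_isom IA_near E'_univ]]]] :=
  exists_amalgam HK eps2 le_eps2 IA_emb.
have [F' [iF [iB [iF_isom iB_isom JB_near F'_univ]]]] :=
  exists_amalgam HK eps0 (lexx _) JB_emb.
have [|||T' [T'_ne T'E T'A]] := E'_univ F' (iF \o fop T) (iB \o OB).
- by move=> x; rewrite mul1r /= iF_isom -[leRHS]mul1r fop_nonexp.
- move=> a; rewrite mul1r /= iB_isom -psiB_isom OBE /= -[`|a|]psiA_isom.
  by have := HOmega (psiA a); rewrite mul1r.
- move=> x /=; have -> : iB (OB (IA x)) - iF (fop T x)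
      = iB (OB (IA x) - JB (fop T x)) + (iB (JB (fop T x)) - iF (fop T x)).
    by rewrite linearB addrA subrK.
  rewrite (le_trans (ler_normD _ _))// mulrDl lerD//.
    by rewrite iB_isom -psiB_isom linearB OBE JBE /= IAE IJ.
  rewrite (le_trans (JB_near _))// ler_wpM2l ?(ltW eps0)//.
  by have := @fop_nonexp _ T x; rewrite mul1r.
pose e := @Extension _ T (FinOp T'_ne) iE iF iE_isom iF_isom T'E.
have [s' [dE cE]] : exists s' : state (FinOp T'_ne),
    sdom s' = Overlap iA_isom psiA_isom /\ scod s' = Overlap iB_isom psiB_isom.
  have compat (a : A) : exists b : B, T' (iA a) = iB b /\ Omega (psiA a) = psiB b.
    by exists (OB a); rewrite T'A OBE.
  by exists (@State (FinOp T'_ne) (Overlap iA_isom psiA_isom)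
               (Overlap iB_isom psiB_isom) compat).
exists (Move e), s', I, J.
split=> //; rewrite ?dE ?cE; split=> //= x.
- by exists (IA x); rewrite IAE; split.
- exists (JB x); rewrite JBE; split=> //.
  by rewrite (le_trans (JB_near x))// ler_wpM2r.
Qed.

End Round.

(** * Approximation *)

Section Approximation.
Context {K : numFieldType} (HK : real_or_complex K).

Lemma pow2N_small (c d : K) : 0 <= c -> 0 < d ->
  exists n, forall m, (n <= m)%N -> c * pow2N m < d.
Proof.
move=> c0 d0; have c1 : 0 < c + 1 by rewrite ltr_wpDl.
have [n nd] := pow2N_lt HK (divr_gt0 d0 c1); exists n => m nm.
rewrite ltr_pdivlMr// in nd; apply: le_lt_trans nd; rewrite mulrC.
by apply: ler_pM; rewrite ?pow2N_ge0// ?lerDl// le_pow2N.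
Qed.

Lemma ler_addpow2N (a b c : K) n0 : 0 <= c ->
  (forall n, (n0 <= n)%N -> a <= b + c * pow2N n) -> a <= b.
Proof.
move=> c0 abc; apply/ler_addgt0Pr => d d0.
have [n cd] := pow2N_small c0 d0.
rewrite (le_trans (abc (maxn n0 n) _)) ?leq_maxl// lerD2l.
by rewrite ltW// cd// leq_maxr.
Qed.

Lemma eq_approx (X : normedModType K) (x y : X) (c : K) n0 : 0 <= c ->
  (forall n, (n0 <= n)%N -> `|x - y| <= c * pow2N n) -> x = y.
Proof.
move=> c0 xyc; apply/eqP; rewrite -subr_eq0 -normr_le0.
apply: (@ler_addpow2N _ _ _ n0 c0) => n n0n; rewrite add0r; exact: xyc.
Qed.

Lemma denseP (X : normedModType K) (S : set X) :
  dense S <-> forall x e, 0 < e -> exists2 s, S s & `|x - s| < e.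
Proof.
split=> [S_dense x e e0|S_close O [x Ox] O_open].
  have [||s [xs Ss]] := S_dense (ball x e)^°.
  - by exists x; exact: nbhsx_ballx.
  - exact: open_interior.
  exists s => //; move/interior_subset: xs.
  by rewrite -ball_normE.
have /nbhs_ballP[e e0 xO] : nbhs x O by exact: open_nbhs_nbhs.
have [s Ss xs] := S_close x e e0; exists s; split=> //; apply: xO.
by rewrite -ball_normE.
Qed.

Lemma exists_dense_seq (X : normedModType K) : separable_space X ->
  exists v : nat -> X, forall x e, 0 < e -> exists n, `|x - v n| < e.
Proof.
move=> [A /countable_injP[f f_inj] /denseP A_dense].
have /choice[v vP] n : exists x, forall a, A a -> f a = n -> x = a.
  have [[a Aa <-]|nA] := pselect (exists2 a, A a & f a = n).
    by exists a => b Ab ba; apply: f_inj; rewrite ?inE.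
  by exists 0 => a Aa an; case: nA; exists a.
exists v => x e e0; have [a Aa xa] := A_dense x e e0.
by exists (f a); rewrite (vP _ a).
Qed.

(** The errors of the steps from [n] on sum up to at most [2 * c * 2^-n]. *)
Lemma exists_limit (X : completeNormedModType K) (u : nat -> X) (c : K) n0 :
  0 <= c -> (forall n, (n0 <= n)%N -> `|u n.+1 - u n| <= c * pow2N n) ->
  exists l, forall n, (n0 <= n)%N -> `|l - u n| <= (c + c) * pow2N n.
Proof.
move=> c0 u_step.
have u_close n m : (n0 <= n)%N -> (n <= m)%N ->
    `|u m - u n| <= (c + c) * (pow2N n - pow2N m).
  move=> n0n /subnK <-; elim: (m - n)%N => [|k IH].
    by rewrite !subrr normr0 mulr0.
  rewrite addSn; set p := (k + n)%N in IH *.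
  have -> : u p.+1 - u n = (u p.+1 - u p) + (u p - u n) by rewrite addrA subrK.
  have -> : (c + c) * (pow2N n - pow2N p.+1)
      = c * pow2N p + (c + c) * (pow2N n - pow2N p).
    by rewrite -[pow2N p]pow2N_double; ring.
  rewrite (le_trans (ler_normD _ _))// lerD// u_step//.
  by rewrite (leq_trans n0n)// leq_addl.
have u_le n m : (n0 <= n)%N -> (n <= m)%N -> `|u m - u n| <= (c + c) * pow2N n.
  move=> n0n nm; rewrite (le_trans (u_close n m n0n nm))// ler_wpM2l ?addr_ge0//.
  by rewrite gerBl pow2N_ge0.
have /cauchy_cvg/cvg_ex[l ul] : cauchy (u @ \oo).
  apply: cauchy_exP => e e0.
  have [N Ne] := pow2N_small (addr_ge0 c0 c0) e0.
  exists (u (maxn n0 N)); exists (maxn n0 N) => // m /= Nm.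
  rewrite -ball_normE /= distrC (le_lt_trans (u_le _ _ (leq_maxl _ _) Nm))//.
  by rewrite Ne// leq_maxr.
exists l => n n0n; apply/ler_addgt0Pr => e e0.
move/cvgrPdist_le : ul => /(_ e e0)[N _ lN].
have := lN (maxn n N) (leq_maxr _ _) => le_l.
have -> : l - u n = (u (maxn n N) - u n) + (l - u (maxn n N)).
  by rewrite [RHS]addrC addrA subrK.
by rewrite (le_trans (ler_normD _ _))// lerD// u_le// leq_maxl.
Qed.

End Approximation.

(** * Limits of chains *)

Section Chains.
Context {K : numFieldType} (HK : real_or_complex K).
Context (E : nat -> normedVectType K) (e : forall n, {linear E n -> E n.+1}).
Hypothesis e_isom : forall n, isometric_map (e n).

(** [push n m] is the map [E n -> E m] of the chain when [n <= m]; its values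
    for [m < n] are irrelevant. *)
Lemma exists_push : exists push : forall n m, {linear E n -> E m},
  [/\ forall n x, push n n x = x,
      forall n m x, (n <= m)%N -> push n m.+1 x = e m (push n m x),
      forall n m x, (n < m)%N -> push n.+1 m (e n x) = push n m x
    & forall n m x, (n <= m)%N -> `|push n m x| = `|x| ].
Proof.
pose cast n m : {linear E n -> E m} :=
  if n =P m is ReflectT nm then ecast i {linear E n -> E i} nm idfun else \0.
pose fix push n m : {linear E n -> E m} := match m with
  | 0 => cast n 0
  | k.+1 => if (n <= k)%N then (e k \o push n k : {linear E n -> E k.+1})
            else cast n k.+1
  end.
have cast_id n x : cast n n x = x.
  by rewrite /cast; case: eqP => // nn; rewrite (eq_axiomK nn).
have push_id n x : push n n x = x.
  by case: n x => [|n] x /=; rewrite ?ltnn cast_id.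
have pushS n m x : (n <= m)%N -> push n m.+1 x = e m (push n m x).
  by move=> /= ->.
exists push; split=> //.
  move=> n m x /subnK <-; elim: (m - n.+1)%N => [|k IH].
    by rewrite add0n push_id pushS// push_id.
  by rewrite addSn !pushS ?IH// ?leq_addl// addnS leqW// leq_addl.
move=> n m x /subnK <-; elim: (m - n)%N => [|k IH]; first by rewrite push_id.
by rewrite addSn pushS ?leq_addl// e_isom.
Qed.

(** A sequence of almost isometric embeddings of the spaces of even index that
    refines a sequence of overlaps converges to isometric embeddings of all the
    spaces of the chain, whose images have a dense union. *)
Lemma exists_limit_embedding (G : completeNormedModType K) (v : nat -> G)
    (s : forall k, overlap G (E k.*2)) (I : forall k, {linear E k.*2 -> G}) :
  (forall x d, 0 < d -> exists n, `|x - v n| < d) ->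
  (forall k, refines v k (e k.*2.+1 \o e k.*2) (s k) (s k.+1) (I k)) ->
  exists C : completion_of_union e G,
    forall k x, `|Defs.incl C k.*2 x - I k x| <= 12%:R * `|x| * pow2N k.
Proof.
move=> v_dense sI.
have I_le k x : `|I k x| <= (1 + pow2N k) * `|x|.
  by have /andP[_] := refines_emb (sI k) x.
have I_step k x :
    `|I k.+1 (e k.*2.+1 (e k.*2 x)) - I k x| <= 6%:R * `|x| * pow2N k.
  have [a [aI a_near]] := refines_in (sI k) x.
  have := refines_near (sI k.+1) a; rewrite aI => a_near'.
  set y := e _ _; pose b := toE (s k.+1) a; rewrite -/b in a_near a_near'.
  have -> : I k.+1 y - I k x = (I k.+1 b - I k x) - I k.+1 (b - y).
    by rewrite linearB opprB [RHS]addrC subrKA.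
  have pk1 : pow2N k.+1 <= pow2N k :> K by exact: le_pow2N.
  have normI (l : nat) z : `|I l z| <= 2%:R * `|z|.
    rewrite (le_trans (I_le _ _))// ler_wpM2r//.
    by rewrite -[2%:R]/(1 + 1) lerD2l pow2N_le1.
  have -> : 6%:R * `|x| * pow2N k
      = pow2N k * (2%:R * `|x|) + 2%:R * ((pow2N k + pow2N k) * `|x|) by ring.
  rewrite (le_trans (ler_normB _ _))// lerD//.
    rewrite (le_trans a_near')// ler_pM ?pow2N_ge0//.
    by rewrite -[`|a|](@toG_isom _ _ _ (s k.+1)) aI.
  by rewrite (le_trans (normI _ _))// ler_wpM2l.
have [push [push_id pushS push_e push_isom]] := exists_push.
pose u n x k := I k (push n k.*2 x).
have u_step n x k : (uphalf n <= k)%N ->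
    `|u n x k.+1 - u n x k| <= 6%:R * `|x| * pow2N k.
  rewrite leq_uphalf_double => nk; rewrite -(push_isom _ _ x nk) /u.
  have -> : push n k.+1.*2 x = e k.*2.+1 (e k.*2 (push n k.*2 x)).
    by rewrite -!pushS// leqW.
  exact: I_step.
have exL n : exists L : E n -> G, forall x k, (n <= k.*2)%N ->
    `|L x - u n x k| <= 12%:R * `|x| * pow2N k.
  suff /choice[L LP] x : exists l, forall k, (n <= k.*2)%N ->
    `|l - u n x k| <= 12%:R * `|x| * pow2N k by exists L.
  have [|l lP] := exists_limit HK _ (u_step n x); first by rewrite mulr_ge0.
  exists l => k nk; have := lP k; rewrite leq_uphalf_double => /(_ nk).
  suff -> : 6%:R * `|x| + 6%:R * `|x| = 12%:R * `|x| by [].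
  by ring.
pose L n := sval (cid (exL n)).
have LP n x k : (n <= k.*2)%N -> `|L n x - u n x k| <= 12%:R * `|x| * pow2N k.
  exact: (svalP (cid (exL n))).
have le_double n k : (n <= k)%N -> (n <= k.*2)%N.
  by move=> /leq_trans; apply; rewrite -addnn leq_addr.
have L_lin n : linear (L n).
  move=> l x y.
  apply: (@eq_approx _ HK _ _ _ (12%:R * `|l *: x + y|
    + (`|l| * (12%:R * `|x|) + 12%:R * `|y|)) n).
    by rewrite !addr_ge0 ?mulr_ge0.
  move=> k /le_double nk.
  have -> : L n (l *: x + y) - (l *: L n x + L n y) =
      (L n (l *: x + y) - u n (l *: x + y) k)
      - (l *: (L n x - u n x k) + (L n y - u n y k)).
    have -> : u n (l *: x + y) k = l *: u n x k + u n y k.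
      by rewrite /u !linearP.
    by rewrite scalerBr addrACA -opprD opprB addrA subrK.
  rewrite (le_trans (ler_normB _ _))// mulrDl lerD ?LP//.
  rewrite (le_trans (ler_normD _ _))// mulrDl lerD ?LP// normrZ.
  by rewrite -[leRHS]mulrA ler_wpM2l// LP.
have L_isom n x : `|L n x| = `|x|.
  have c0 : 0 <= 13%:R * `|x| by rewrite mulr_ge0.
  have c13 k : 13%:R * `|x| * pow2N k
      = 12%:R * `|x| * pow2N k + pow2N k * `|x| by ring.
  apply/eqP; rewrite eq_le; apply/andP; split.
    apply: (@ler_addpow2N _ HK _ _ _ n c0) => k /le_double nk.
    rewrite c13 -{1}[L n x](subrK (u n x k)) (le_trans (ler_normD _ _))//.
    rewrite addrCA lerD ?LP// (le_trans (I_le _ _))// push_isom//.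
    by rewrite mulrDl mul1r.
  apply: (@ler_addpow2N _ HK _ _ _ n c0) => k /le_double nk.
  have /andP[+ _] := refines_emb (sI k) (push n k.*2 x).
  rewrite push_isom// mulrBl mul1r lerBlDr => /le_trans; apply.
  rewrite c13 addrA lerD2r -/(u n x k).
  rewrite -{1}[u n x k](subKr (L n x)) (le_trans (ler_normB _ _))//.
  by rewrite lerD2l LP.
have L_e n x : L n.+1 (e n x) = L n x.
  apply: (@eq_approx _ HK _ _ _ (12%:R * `|x| + 12%:R * `|x|) n.+1).
    by rewrite addr_ge0 ?mulr_ge0.
  move=> k /le_double nk.
  have -> : L n.+1 (e n x) - L n x
      = (L n.+1 (e n x) - u n.+1 (e n x) k) - (L n x - u n x k).
    by rewrite /u push_e// opprB addrA subrK.
  rewrite (le_trans (ler_normB _ _))// mulrDl lerD//.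
    by rewrite (le_trans (LP _ _ _ nk))// e_isom.
  by rewrite LP// ltnW.
pose L' n : {linear E n -> G} := sval (cid (exists_linear (@L_lin n))).
have L'E n x : L' n x = L n x by exact: (svalP (cid (exists_linear (@L_lin n)))).
have L_near k x : `|L' k.*2 x - I k x| <= 12%:R * `|x| * pow2N k.
  by rewrite L'E -{2}[x]push_id LP.
have L'_isom n : isometric_map (L' n) by move=> x; rewrite L'E.
have L'_e n x : L' n.+1 (e n x) = L' n x by rewrite !L'E.
have L'_dense : dense (\bigcup_n range (L' n)).
  apply/denseP => g d d0.
  have d2 : 0 < d / 2%:R by rewrite divr_gt0.
  have [m gv] := v_dense g _ d2.
  have c0 : 0 <= 13%:R * `|v m| by rewrite mulr_ge0.
  have [k0 k0_small] := pow2N_small HK c0 d2.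
  pose k := maxn k0 m.
  have [a av] := refines_seq (sI k) (leq_maxr _ _).
  pose x := toE (s k.+1) a.
  have x_norm : `|x| = `|v m| by rewrite toE_isom -av toG_isom.
  exists (L' k.+1.*2 x); first by exists k.+1.*2.
  have -> : g - L' k.+1.*2 x = (g - v m)
      - ((L' k.+1.*2 x - I k.+1 x) + (I k.+1 x - v m)).
    by rewrite addrA subrK opprB addrA subrK.
  rewrite (le_lt_trans (ler_normB _ _))// (_ : d = d / 2%:R + d / 2%:R).
    rewrite ltrD// (le_lt_trans _ (k0_small k.+1 _)) ?leqW ?leq_maxl//.
    have -> : 13%:R * `|v m| * pow2N k.+1
        = 12%:R * `|x| * pow2N k.+1 + pow2N k.+1 * `|v m| by rewrite x_norm; ring.
    rewrite (le_trans (ler_normD _ _))// lerD//.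
    by rewrite -av toG_isom (refines_near (sI k.+1)).
  by rewrite -splitr.
by exists (CompletionOfUnion L'_isom L'_e L'_dense).
Qed.

End Chains.

(** * Uniqueness of the completion of a chain *)

Section Uniqueness.
Context {K : numFieldType} (HK : real_or_complex K).
Context (E : nat -> normedVectType K) (e : forall n, {linear E n -> E n.+1}).
Hypothesis e_isom : forall n, isometric_map (e n).

Lemma exists_common_stage n m (x : E n) (y : E m) :
  exists N (x' y' : E N), forall (X : completeNormedModType K)
    (C : completion_of_union e X),
    Defs.incl C N x' = Defs.incl C n x /\ Defs.incl C N y' = Defs.incl C m y.
Proof.
have [push [push_id pushS _ _]] := exists_push e_isom.
have inclE X (C : completion_of_union e X) k l (z : E k) : (k <= l)%N ->
    Defs.incl C l (push k l z) = Defs.incl C k z.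
  move=> /subnK <-; elim: (l - k)%N => [|j IH]; first by rewrite push_id.
  by rewrite addSn pushS ?leq_addl// incl_comp.
exists (maxn n m), (push n _ x), (push m _ y) => X C.
by rewrite !inclE ?leq_maxl ?leq_maxr.
Qed.

Section Transfer.
Context (X Y : completeNormedModType K).
Context (C : completion_of_union e X) (D : completion_of_union e Y).

Lemma incl_dist n m (x : E n) (y : E m) :
  `|Defs.incl D n x - Defs.incl D m y| = `|Defs.incl C n x - Defs.incl C m y|.
Proof.
have [N [x' [y' xy']]] := exists_common_stage x y.
have [<- <-] := xy' _ C; have [<- <-] := xy' _ D.
by rewrite -!linearB !incl_isom.
Qed.

(** [h] corresponds to [g]: it lies at most as far from every element of the
    chain. As the chain is dense, this says that the same sequences of its
    elements converge to [g] in [X] and to [h] in [Y]. *)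
Definition same_limit (g : X) (h : Y) : Prop :=
  forall n x, `|h - Defs.incl D n x| <= `|g - Defs.incl C n x|.

Lemma same_limit_norm g h : same_limit g h -> `|h| <= `|g|.
Proof. by move/(_ 0%N 0); rewrite ![Defs.incl _ _ 0]linear0 !subr0. Qed.

Lemma exists_near g k : exists n x, `|g - Defs.incl C n x| <= pow2N k.
Proof.
have /denseP/(_ g _ (@pow2N_gt0 _ k))[_ [n _ [x _ <-]] gx] := incl_dense C.
by exists n, x; rewrite ltW.
Qed.

Lemma same_limit_inj g h h' : same_limit g h -> same_limit g h' -> h = h'.
Proof.
move=> gh gh'; apply: (@eq_approx _ HK _ _ _ (1 + 1) 0) => // k _.
have [n [x gx]] := exists_near g k.
rewrite -[h](subrK (Defs.incl D n x)) -addrA mulrDl mul1r.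
rewrite (le_trans (ler_normD _ _))// lerD ?(le_trans (gh _ _))//.
by rewrite distrC (le_trans (gh' _ _)).
Qed.

Lemma exists_same_limit g : exists h, same_limit g h.
Proof.
have /choice[z gz] k : exists z : {n & E n},
    `|g - Defs.incl C (tag z) (tagged z)| <= pow2N k.
  by have [n [x gx]] := exists_near g k; exists (Tagged E x).
pose w k := Defs.incl C (tag (z k)) (tagged (z k)).
pose u k := Defs.incl D (tag (z k)) (tagged (z k)).
have u_step k : (0 <= k)%N -> `|u k.+1 - u k| <= (1 + 1) * pow2N k.
  move=> _.
  rewrite incl_dist -/(w k.+1) -/(w k).
  have -> : w k.+1 - w k = (g - w k) - (g - w k.+1).
    by rewrite opprB [RHS]addrC addrA subrK.
  rewrite (le_trans (ler_normB _ _))// mulrDl mul1r lerD ?gz//.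
  by rewrite (le_trans (gz _))// le_pow2N.
have [|h hu] := exists_limit HK _ u_step; first by [].
exists h => n x; have c0 : 0 <= 1 + 1 + (1 + 1) + 1 :> K by [].
apply: (@ler_addpow2N _ HK _ _ _ 0%N c0) => k _; rewrite mulrDl mul1r.
rewrite -[h](subrK (u k)) -addrA (le_trans (ler_normD _ _))//.
rewrite addrCA lerD ?hu// incl_dist -/(w k) -[w k](subKr g) addrAC.
by rewrite (le_trans (ler_normB _ _))// lerD2l gz.
Qed.

Lemma same_limit_linear (l : K) g g' h h' : same_limit g h -> same_limit g' h' ->
  same_limit (l *: g + g') (l *: h + h').
Proof.
move=> gh gh' n x.
have c0 : 0 <= (`|l| + 1) + (`|l| + 1) by rewrite !addr_ge0.
apply: (@ler_addpow2N _ HK _ _ _ 0%N c0) => k _.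
have [m [y gy]] := exists_near g k; have [m' [y' gy']] := exists_near g' k.
have [N [z [z' zE]]] := exists_common_stage y y'.
have dist_le (X' : completeNormedModType K) (C' : completion_of_union e X') f f' :
    `|f - Defs.incl C' m y| <= pow2N k -> `|f' - Defs.incl C' m' y'| <= pow2N k ->
    `|l *: f + f' - Defs.incl C' N (l *: z + z')| <= (`|l| + 1) * pow2N k.
  move=> fy fy'; have [zy zy'] := zE _ C'.
  rewrite linearP /= zy zy' opprD addrACA -scalerBr.
  by rewrite (le_trans (ler_normD _ _))// mulrDl mul1r normrZ lerD// ler_wpM2l.
rewrite -[l *: h + h'](subrK (Defs.incl D N (l *: z + z'))) -addrA.
rewrite (le_trans (ler_normD _ _))// [_ * pow2N k]mulrDl addrCA lerD//.
  by apply: dist_le; [exact: le_trans (gh _ _) _ | exact: le_trans (gh' _ _) _].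
rewrite incl_dist -[Defs.incl C N _](subKr (l *: g + g')) addrAC.
by rewrite (le_trans (ler_normB _ _))// lerD2l dist_le.
Qed.

End Transfer.

Lemma completion_unique (X Y : completeNormedModType K)
    (C : completion_of_union e X) (D : completion_of_union e Y) :
  exists j : {linear X -> Y}, [/\ bijective j, isometric_map j
    & forall n x, j (Defs.incl C n x) = Defs.incl D n x].
Proof.
have [f fP] := choice (exists_same_limit C D).
have [f' f'P] := choice (exists_same_limit D C).
have cancel_lim (X' Y' : completeNormedModType K)
    (C' : completion_of_union e X') (D' : completion_of_union e Y') g h g' :
    same_limit C' D' g h -> same_limit D' C' h g' -> g' = g.
  move=> gh hg'; apply: (@same_limit_inj _ _ C' C' g) => // n x.
  exact: le_trans (hg' n x) (gh n x).
have f_lin : linear f.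
  move=> l g g'; apply: (@same_limit_inj _ _ C D (l *: g + g')) => //.
  exact: same_limit_linear.
have [j jE] := exists_linear f_lin; exists j; split.
- exists f' => g; rewrite !jE; first exact: cancel_lim (fP g) (f'P (f g)).
  exact: cancel_lim (f'P g) (fP (f' g)).
- move=> g; rewrite jE; apply/eqP; rewrite eq_le (same_limit_norm (fP g)) /=.
  have := same_limit_norm (f'P (f g)).
  by rewrite (cancel_lim _ _ _ _ _ _ _ (fP g) (f'P (f g))).
- move=> n x; rewrite jE; apply/eqP; rewrite -subr_eq0 -normr_le0.
  by rewrite (le_trans (fP _ n x))// subrr normr0.
Qed.

End Uniqueness.

(** * Adam's strategy *)

Section Strategy.
Context {K : numFieldType} (HK : real_or_complex K).
Context {G : completeNormedModType K} (Omega : {linear G -> G}) (v : nat -> G).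
Hypotheses (HOmega : nonexpansive Omega) (HOmegaG : gurarii_operator Omega).

(** The state that Adam reads off a history: whenever one of his moves can be
    completed to a good round, he chooses such a completion; otherwise, and
    after the moves of Eve, the state is only transported. *)
Fixpoint state_of n (T : fin_op K) (h : history n T) : state Omega T :=
  match h with
  | Start T => state0 Omega T
  | Step n T T' h e =>
    let s := state_of h in
    if odd n then state_push e s else
    if pselect (exists s' I J, good_round v n./2 e s s' I J) is left ex
    then sval (cid ex) else state_push e s
  end.

(** Following his strategy, Adam obtains a good round at every even stage. The
    extensions composed below are Adam's answer and Eve's next move. *)
Lemma exists_strategy : exists a : adam_strategy K,
  forall p : play K, follows a p ->
  exists (s : forall k, state Omega (op_at p k.*2))
    (I : forall k, {linear fdom (op_at p k.*2) -> G})
    (J : forall k, {linear fcod (op_at p k.*2) -> G}), forall k,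
    [/\ refines v k (edom (ext_at p k.*2.+1) \o edom (ext_at p k.*2))
          (sdom (s k)) (sdom (s k.+1)) (I k),
        refines v k (ecod (ext_at p k.*2.+1) \o ecod (ext_at p k.*2))
          (scod (s k)) (scod (s k.+1)) (J k)
      & opnorm_le (pow2N k) (fun x => Omega (I k x) - J k (fop (op_at p k.*2) x))].
Proof.
pose answer n T (h : history n T) :=
  cid (exists_good_round HK v HOmega HOmegaG n./2 (state_of h)).
exists (fun n T h => sval (answer n T h)) => p p_follows.
pose s k := state_of (history_of p k.*2).
have round k : exists I J, good_round v k (ext_at p k.*2) (s k)
    (state_of (history_of p k.*2.+1)) I J.
  have : exists s' I J, good_round v k (ext_at p k.*2) (s k) s' I J.
    have := svalP (answer _ _ (history_of p k.*2)).
    by rewrite -p_follows doubleK.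
  rewrite /s /= odd_double doubleK => ex.
  by case: pselect => // ex'; exact: svalP (cid ex').
exists s, (fun k => sval (cid (round k))),
  (fun k => sval (cid (svalP (cid (round k))))) => k.
have [E_round F_round IJ] := svalP (cid (svalP (cid (round k)))).
have odd_step n : odd n ->
    state_of (history_of p n.+1) = state_push (ext_at p n) (state_of (history_of p n)).
  by move=> /= ->.
have -> : s k.+1 = state_push (ext_at p k.*2.+1) (state_of (history_of p k.*2.+1)).
  by apply: odd_step; rewrite /= odd_double.
by split=> //; exact: refines_push.
Qed.

End Strategy.

Section Intertwining.
Context {K : numFieldType} (HK : real_or_complex K).
Context {G : completeNormedModType K} (Omega : {linear G -> G}).
Hypothesis HOmega : nonexpansive Omega.
Variable p : play K.

(** The defect [Omega (incl n x) - incl n (T_n x)] does not change when [x] is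
    moved along the chain, so it is enough that it tends to [0] along the even
    stages. *)
Lemma limit_intertwines
    (C : completion_of_union (fun n => edom (ext_at p n)) G)
    (D : completion_of_union (fun n => ecod (ext_at p n)) G)
    (I : forall k, {linear fdom (op_at p k.*2) -> G})
    (J : forall k, {linear fcod (op_at p k.*2) -> G}) (c : K) : 0 <= c ->
  (forall k x, `|Defs.incl C k.*2 x - I k x| <= c * `|x| * pow2N k) ->
  (forall k y, `|Defs.incl D k.*2 y - J k y| <= c * `|y| * pow2N k) ->
  (forall k, opnorm_le (pow2N k)
     (fun x => Omega (I k x) - J k (fop (op_at p k.*2) x))) ->
  forall n x, Omega (Defs.incl C n x) = Defs.incl D n (fop (op_at p n) x).
Proof.
move=> c0 CI DJ IJ n x.
pose d m z := Omega (Defs.incl C m z) - Defs.incl D m (fop (op_at p m) z).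
have d_step m z : d m.+1 (edom (ext_at p m) z) = d m z.
  by rewrite /d ext_fop (incl_comp C) (incl_comp D).
have lift m : (n <= m)%N -> exists2 z, `|z| = `|x| & d m z = d n x.
  move=> /subnK <-; elim: (m - n)%N => [|k [z zx dz]]; first by exists x.
  exists (edom (ext_at p (k + n)) z); first by rewrite edom_isom.
  exact: etrans (d_step _ _) dz.
have c1 : 0 <= (c + 1 + c) * `|x| by rewrite mulr_ge0 ?addr_ge0.
apply: (@eq_approx _ HK _ _ _ _ n c1) => k nk.
rewrite -/(d n x).
have [|z <- <-] := lift k.*2; first by rewrite (leq_trans nk)// -addnn leq_addr.
have Tz : `|fop (op_at p k.*2) z| <= `|z|.
  by rewrite -[leRHS]mul1r fop_nonexp.
rewrite /d; set w := fop _ z in Tz *.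
have -> : Omega (Defs.incl C k.*2 z) - Defs.incl D k.*2 w =
    Omega (Defs.incl C k.*2 z - I k z) + (Omega (I k z) - J k w)
    - (Defs.incl D k.*2 w - J k w).
  by rewrite linearB addrA subrK opprB addrA subrK.
rewrite (_ : (c + 1 + c) * _ * _ =
  c * `|z| * pow2N k + pow2N k * `|z| + c * `|z| * pow2N k); last by ring.
rewrite (le_trans (ler_normB _ _))// lerD//.
  rewrite (le_trans (ler_normD _ _))// lerD ?IJ//.
  by rewrite (le_trans (HOmega _))// mul1r CI.
by rewrite (le_trans (DJ _ _))// ler_wpM2r ?pow2N_ge0// ler_wpM2l.
Qed.

End Intertwining.

Theorem theorem4p1 (K : numFieldType) (HK : real_or_complex K)
  (G : completeNormedModType K) (HG : gurarii_space G)
  (Omega : {linear G -> G}) (HOmega : nonexpansive Omega)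
  (HOmegaG : gurarii_operator Omega) :
  generic Omega.
Proof.
have [v v_dense] := exists_dense_seq HG.1.
have [a a_wins] := exists_strategy HK v HOmega HOmegaG.
exists a => p /a_wins[s [I [J sIJ]]].
have dom_isom n : isometric_map (edom (ext_at p n)) by exact: edom_isom.
have cod_isom n : isometric_map (ecod (ext_at p n)) by exact: ecod_isom.
have [|C CI] :=
  exists_limit_embedding HK dom_isom (s := fun k => sdom (s k)) (I := I) v_dense.
  by move=> k; case: (sIJ k).
have [|D DJ] :=
  exists_limit_embedding HK cod_isom (s := fun k => scod (s k)) (I := J) v_dense.
  by move=> k; case: (sIJ k).
have CD n x : Omega (Defs.incl C n x) = Defs.incl D n (fop (op_at p n) x).
  by apply: (limit_intertwines HK HOmega _ CI DJ) => // k; case: (sIJ k).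
(* G, with C and D, is itself a completion of the two unions *)
split; first by constructor; exact: (@LimitOperator _ p G G C D Omega HOmega CD).
case=> X Y CX DY U U_ne U_ext.
have [j [j_bij j_isom jC]] := completion_unique HK dom_isom C CX.
have [i [i_bij i_isom iD]] := completion_unique HK cod_isom D DY.
(* U \o j and i \o Omega agree on the dense union of the chain *)
exists i, j; split=> //= g.
apply: (@eq_approx _ HK _ _ _ (1 + 1) 0) => // k _.
have [n [x gx]] := exists_near C g k.
pose w := Defs.incl C n x; rewrite -/w in gx.
have -> : U (j g) - i (Omega g) = U (j (g - w)) - i (Omega (g - w)).
  rewrite [j (_ - _)]linearB [U (_ - _)]linearB (linearB Omega).
  rewrite [i (_ - _)]linearB opprB addrA.
  have -> : U (j w) = i (Omega w) by rewrite /w jC U_ext CD iD.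
  by rewrite subrK.
rewrite (le_trans (ler_normB _ _))// mulrDl mul1r lerD// ?i_isom.
  by rewrite (le_trans (U_ne _))// mul1r j_isom.
by rewrite (le_trans (HOmega _))// mul1r.
Qed.
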